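(* Let $n\ge 1$ and let $A\in\mathcal{M}_n$ be a real $n\times n$ matrix. Then a skew-square-spectral approximant $U^{\star}[A]$ of $A$ is a solution of the problem $$\operatorname*{argmin}_{U\in\mathcal{K}^{\mathrm{sq}}_n}\|U-A\|_F ,$$ that is, $U^{\star}[A]\in\mathcal{K}^{\mathrm{sq}}_n$ and $\|U^{\star}[A]-A\|_F\le\|U-A\|_F$ for every $U\in\mathcal{K}^{\mathrm{sq}}_n$. (This holds for $U^{\star}[A]$ constructed from any spectral decomposition of the symmetric part of $A$ of the form described in the context.)
   Context: $\mathcal{M}_n$ is the space of real $n\times n$ matrices with the Frobenius inner product $\langle X,Y\rangle_F=\sum_{i=1}^n\sum_{j=1}^n X_{ij}Y_{ij}$ and induced norm $\|X\|_F=\sqrt{\langle X,X\rangle_F}$. $\mathcal{K}_n\subset\mathcal{M}_n$ is the subspace of real skew-symmetric matrices, and $\mathcal{K}^{\mathrm{sq}}_n=\{K^2 : K\in\mathcal{K}_n\}$. $\mathcal{O}_n$ is the set of real orthogonal $n\times n$ matrices. $\mathrm{diag}_n[a_1,\dots,a_n]$ is the $n\times n$ diagonal matrix with diagonal entries $a_1,\dots,a_n$ in this order. Skew-square-spectral approximant: Let $A\in\mathcal{M}_n$ and $B=(A+A^{\mathsf T})/2$. By the real spectral theorem, $B=N\Lambda N^{\mathsf T}$ with $N\in\mathcal{O}_n$ and $\Lambda=\mathrm{diag}_n[\lambda_1,\dots,\lambda_n]$, where $\lambda_1\ge\lambda_2\ge\dots\ge\lambda_n$ are real. Define $U^{\star}[A]:=N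 D^{\star}N^{\mathsf T}$, where the diagonal matrix $D^{\star}$ is as follows. If $n$ is even, let $k=n/2$ and $D^{\star}=\mathrm{diag}_n[\mu_1^{\star},\mu_1^{\star},\dots,\mu_k^{\star},\mu_k^{\star}]$, where for $i=1,\dots,k$, $\mu_i^{\star}=(\lambda_{2i-1}+\lambda_{2i})/2$ if $\lambda_{2i-1}+\lambda_{2i}\le 0$, and $\mu_i^{\star}=0$ otherwise. If $n$ is odd, let $k=(n-1)/2$ and $D^{\star}=\mathrm{diag}_n[0,\mu_1^{\star},\mu_1^{\star},\dots,\mu_k^{\star},\mu_k^{\star}]$, where for $i=1,\dots,k$, $\mu_i^{\star}=(\lambda_{2i}+\lambda_{2i+1})/2$ if $\lambda_{2i}+\lambda_{2i+1}\le 0$, and $\mu_i^{\star}=0$ otherwise. *)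

(* Defs.v *)
From HB Require Import structures.
From mathcomp Require Import all_boot all_order all_algebra.
From mathcomp Require Import all_classical all_reals.

Set Implicit Arguments.
Unset Strict Implicit.
Unset Printing Implicit Defensive.

Import Order.TTheory GRing.Theory Num.Theory.

Local Open Scope classical_set_scope.
Local Open Scope ring_scope.

Section SkewSquareSpectral.
Variables (R : realType) (n : nat).
Implicit Types (A N X Y : 'M[R]_n) (lambda : nat -> R).

Definition frob_inner X Y : R := \sum_(i < n) \sum_(j < n) X i j * Y i j.

Definition frob_norm X : R := Num.sqrt (frob_inner X X).

Definition skew_sq_mx : set 'M[R]_n := [set K *m K | K in [set K | K \is skewmx]].

Definition orthogonal_mx : set 'M[R]_n := [set N | N^T *m N = 1%:M].

Definition sym_part A : 'M[R]_n := 2^-1 *: (A + A^T).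

(* Families are indexed from 1, so the diagonal is a 1, ..., a n; the values
   of [a] at 0 and beyond n are irrelevant. *)
Definition diagn (a : nat -> R) : 'M[R]_n := diag_mx (\row_(p < n) a p.+1).

Definition spectral_decomposition A N lambda : Prop :=
  [/\ orthogonal_mx N,
      forall i j : nat,
        (1 <= i)%N -> (i <= j)%N -> (j <= n)%N -> lambda j <= lambda i
    & sym_part A = N *m diagn lambda *m N^T].

Definition pair_sum lambda (i : nat) : R :=
  if odd n then lambda (2 * i)%N + lambda (2 * i + 1)%N
  else lambda (2 * i - 1)%N + lambda (2 * i)%N.

Definition mu_star lambda (i : nat) : R :=
  if pair_sum lambda i <= 0 then pair_sum lambda i / 2 else 0.

(* The j-th diagonal entry of D*, 1 <= j <= n.  For n odd, j = 2i and
   j = 2i + 1 carry mu_i; for n even, j = 2i - 1 and j = 2i do. *)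
Definition d_star lambda (j : nat) : R :=
  if odd n then
    if j == 1%N then 0 else mu_star lambda (j %/ 2)
  else mu_star lambda ((j + 1) %/ 2).

Definition skew_square_approximant N lambda : 'M[R]_n :=
  N *m diagn (d_star lambda) *m N^T.

End SkewSquareSpectral.

Arguments skew_sq_mx : clear implicits.
Arguments orthogonal_mx : clear implicits.

(* Main.v *)
Require Import Defs.
From mathcomp Require Import all_boot all_order all_algebra.
From mathcomp Require Import all_classical all_reals.
From mathcomp Require Import perm complex.
From mathcomp Require Import zify ring lra.

(** Why the theorem holds.  Let [U = K *m K] with [K] skew, and let
    [V := N^T *m U *m N], again the square of a skew matrix.  Because [U] is
    symmetric, only the symmetric part of [A] meets it, so that
      [|U - A|^2 = tr (V V) - 2 \sum_i lambda_i V_ii + |A|^2]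
    ([frob_dist_conj]) and the problem is to minimise the first two terms.

    Over the complex numbers a real skew matrix is unitarily diagonalisable
    with purely imaginary eigenvalues [i r_j].  Hence the diagonal of [V] is
    [V_ii = \sum_j w_ij m_j] with [m_j = - r_j^2 <= 0] the eigenvalues of [V]
    and [w_ij = |P_ji|^2] doubly stochastic ([skew_square_spectral]).  Once the
    [m_j] are sorted decreasingly, the rearrangement inequality for doubly
    stochastic weights ([doubly_stochastic_rearrangement]) gives
      [tr (V V) - 2 \sum_i lambda_i V_ii >= \sum_i (m_i^2 - 2 lambda_i m_i)].

    A skew matrix and its opposite have the same characteristic polynomial,
    being transposes of each other, so the [r_j] are symmetric about 0 and each
    nonzero [m_j] has even multiplicity.  In sorted order the [m_j] therefore
    coincide in consecutive pairs, counted from the bottom, and a leftover top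
    one vanishes ([sorted_nonpos_pairing]).  These are exactly the pairs used
    by the approximant, and the lower bound splits into the independent
    problems of minimising [2 (m^2 - (lambda_a + lambda_b) m)] over [m <= 0],
    which [mu_star] solves ([mu_star_min]).

    Conversely the diagonal matrix of the approximant is the square of a skew
    block matrix, because its entries are nonpositive, paired, and zero
    where unpaired ([approximant_skew_sq]). *)

Set Implicit Arguments.
Unset Strict Implicit.
Unset Printing Implicit Defensive.

Import Order.TTheory GRing.Theory Num.Theory.

Local Open Scope ring_scope.
Local Open Scope sesquilinear_scope.

(** * Rearrangement with doubly stochastic weights *)

(** Abel summation, carried out as an induction: when a term is added, the
    nonnegative partial sum of [y] may be multiplied by the next, smaller,
    value of [a]. *)
Lemma sum_mul_ge_last (R : realDomainType) (n : nat) (a y : nat -> R) :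
  (forall i j, (i <= j < n)%N -> a j <= a i) ->
  (forall k, (k < n)%N -> 0 <= \sum_(i < k) y i) ->
  forall k, (k < n)%N ->
  a k * (\sum_(i < k.+1) y i) <= \sum_(i < k.+1) a i * y i.
Proof.
move=> a_noninc y_ge0; elim=> [|k IHk] lt_kn; first by rewrite !big_ord1.
rewrite big_ord_recr [leRHS]big_ord_recr /= mulrDr lerD2r.
apply: le_trans (IHk (ltnW lt_kn)).
by rewrite ler_wpM2r ?y_ge0 // a_noninc // leqnSn.
Qed.

(** Moving weight from lower to higher values of [m] increases the sum.
    Formally, with the value [m k] as a threshold, the difference of the two
    sums is a sum of products of factors of equal sign. *)
Lemma sum_weights_le_top (R : realDomainType) (n k : nat) (m : nat -> R)
    (c : 'I_n -> R) :
  (forall i j, (i <= j < n)%N -> m j <= m i) -> (k < n)%N ->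
  (forall j, 0 <= c j <= 1) -> \sum_j c j = k.+1%:R ->
  \sum_j c j * m j <= \sum_(j < k.+1) m j.
Proof.
move=> m_noninc lt_kn c01 sum_c.
rewrite (big_ord_widen _ (fun j => m j) lt_kn) [leRHS]big_mkcond /=.
have sum_top : \sum_(j < n) (j < k.+1)%:R = k.+1%:R :> R.
  transitivity (\sum_(j < k.+1) (1 : R)); last by rewrite sumr_const card_ord.
  rewrite (big_ord_widen _ (fun=> 1 : R) lt_kn) [RHS]big_mkcond /=.
  by apply: eq_bigr => j _; case: ifP.
rewrite -subr_ge0 -sumrB.
have -> : \sum_(j < n) ((if (j < k.+1)%N then m j else 0) - c j * m j) =
          \sum_(j < n) ((j < k.+1)%:R - c j) * (m j - m k).
  under [RHS]eq_bigr do rewrite mulrBr.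
  rewrite [RHS]sumrB -[X in _ = _ - X]mulr_suml.
  rewrite [X in X * m k]sumrB sum_top sum_c subrr mul0r subr0;
    apply: eq_bigr => j _.
  by case: ifP => _; rewrite mulrBl ?mul1r ?mul0r.
apply: sumr_ge0 => j _; have /andP[c_ge0 c_le1] := c01 j.
case: (ltnP j k.+1) => [le_jk|lt_kj].
  by rewrite mulr_ge0 ?subr_ge0 // m_noninc // -ltnS le_jk.
by rewrite sub0r mulr_le0 ?oppr_le0 // subr_le0 m_noninc // ltnW ?ltn_ord.
Qed.

(** The averages [\sum_j w i j * m j] have the same total as [m] and, by
    [sum_weights_le_top] applied to partial column sums of [w], smaller initial
    sums; Abel summation against the nonincreasing [a] concludes. *)
Lemma doubly_stochastic_rearrangement (R : realDomainType) (n : nat)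
    (w : 'M[R]_n) (a m : nat -> R) :
  (forall i j, 0 <= w i j) -> (forall i, \sum_j w i j = 1) ->
  (forall j, \sum_i w i j = 1) ->
  (forall i j, (i <= j < n)%N -> a j <= a i) ->
  (forall i j, (i <= j < n)%N -> m j <= m i) ->
  \sum_(i < n) a i * (\sum_(j < n) w i j * m j) <= \sum_(i < n) a i * m i.
Proof.
case: n w => [|n] w w_ge0 rows cols a_noninc m_noninc;
  first by rewrite !big_ord0.
(* The row averages, extended to indices in [nat] for the partial sums. *)
pose x (i : nat) := \sum_(j < n.+1) w (inord i) j * m j.
have partial k : (k < n.+1)%N ->
    \sum_(i < k.+1) x i <= \sum_(i < k.+1) m i.
  move=> lt_kn; rewrite exchange_big /=.
  under eq_bigr do rewrite -mulr_suml.
  apply: sum_weights_le_top => // [j|].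
    rewrite sumr_ge0 //= -(cols j)
      (big_ord_widen _ (fun i => w (inord i) j) lt_kn).
    rewrite big_mkcond ler_sum // => i _; rewrite inord_val.
    by case: ifP.
  rewrite exchange_big /=; under eq_bigr do rewrite rows.
  by rewrite sumr_const card_ord.
have total : \sum_(i < n.+1) (m i - x i) = 0.
  rewrite sumrB; apply/eqP; rewrite subr_eq0 eq_sym; apply/eqP.
  rewrite exchange_big /=; apply: eq_bigr => j _; rewrite -mulr_suml.
  by under eq_bigr do rewrite inord_val; rewrite cols mul1r.
have : 0 <= \sum_(i < n.+1) a i * (m i - x i).
  rewrite -[leLHS](mulr0 (a n)) -[X in a n * X]total.
  apply: (@sum_mul_ge_last _ n.+1 a (fun i => m i - x i)) => // k lt_kn.
  case: k lt_kn => [|k] lt_kn; first by rewrite big_ord0.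
  by rewrite sumrB subr_ge0 partial // ltnW.
under eq_bigr do rewrite mulrBr.
rewrite sumrB subr_ge0; apply: le_trans.
by apply: ler_sum => i _; rewrite /x inord_val.
Qed.

(** * Sequences that come in pairs *)

(** Pairs are peeled off from the bottom end: if the smallest element
    occurred once only, it would have odd multiplicity, hence be 0, and the
    elements above it would be positive.  The pairing is thus anchored at the
    end of [s], so that the positions where pairs start have the parity of the
    size, and what is left over for an odd size is the top element. *)
Lemma sorted_nonpos_pairing (R : realDomainType) (s : seq R) :
  sorted >=%R s -> all (<= 0) s ->
  (forall x, x != 0 -> ~~ odd (count_mem x s)) ->
  (odd (size s) -> s`_0 = 0) /\
  (forall p, odd p = odd (size s) -> (p.+1 < size s)%N -> s`_p = s`_p.+1).
Proof.
rewrite -[s]revK; move: (rev s) => {s} u.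
rewrite rev_sorted all_rev size_rev => u_sorted u_le0 even_u.
have {}even_u x : x != 0 -> ~~ odd (count_mem x u).
  by rewrite -count_rev; apply: even_u.
suff [last0 pairs] : (odd (size u) -> last 0 u = 0) /\
    (forall i, ~~ odd i -> (i.+1 < size u)%N -> u`_i = u`_i.+1).
  split=> [odd_u|p odd_p lt_pu].
    rewrite nth_rev ?subn1 ?nth_last ?last0 //.
    by case: (u) odd_u.
  rewrite !nth_rev ?(ltnW lt_pu) //.
  have -> : (size u - p.+1 = (size u - p.+2).+1)%N by lia.
  by apply/esym/pairs; rewrite ?oddB //= ?negbK ?odd_p ?addbb //; lia.
have [k] := ubnP (size u); elim: k u u_sorted u_le0 even_u => // k IHk.
case=> [|a [|b u]] /=.
- by [].
- move=> _ _ even_u _; split=> // _; apply/eqP.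
  by apply: contraT => /even_u; rewrite /= eqxx.
case/andP=> le_ab bu_sorted /and3P[a_le0 b_le0 u_le0] even_u lt_uk.
have u_ge := order_path_min le_trans bu_sorted.
have eq_ab : a = b.
  apply/eqP; apply: contraT => neq_ab.
  have lt_ab : a < b by rewrite lt_neqAle neq_ab.
  have /even_u : a != 0 by rewrite lt_eqF // (lt_le_trans lt_ab).
  rewrite /= eqxx eq_sym (negPf neq_ab) add0n (count_memPn _) //.
  by apply/negP => /(allP u_ge) /(lt_le_trans lt_ab); rewrite ltxx.
have [||||last0 pairs] := IHk u; rewrite ?(path_sorted bu_sorted) //=.
- by move=> x /even_u; rewrite /= eq_ab addnA addnn oddD odd_double.
- exact: ltnW.
rewrite negbK; split.
  by case: (u) last0.
move=> [|[|i]] //=; rewrite !ltnS negbK; apply: pairs.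
Qed.

(** The preimage of [x] is a pair [y], [- y] of distinct points, which have the
    same multiplicity in a sequence symmetric about 0. *)
Lemma count_opp_sqr_even (R : realFieldType) (s : seq R) (x : R) :
  perm_eq s [seq - y | y <- s] -> x != 0 ->
  ~~ odd (count_mem x [seq - y ^+ 2 | y <- s]).
Proof.
move=> opp_s x_neq0.
have [/mapP[y _ def_x]|/count_memPn -> //] :=
  boolP (x \in [seq - y ^+ 2 | y <- s]).
have y_neq0 : y != 0 by apply: contra_neq x_neq0 => y0;
  rewrite def_x y0 expr0n oppr0.
have -> : count_mem x [seq - y ^+ 2 | y <- s] =
          (count_mem y s + count_mem (- y) s)%N.
  rewrite count_map -count_predUI [X in (_ + X)%N](eq_count (a2 := pred0)).
    rewrite count_pred0 addn0; apply: eq_count => z /=.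
    by rewrite def_x eqr_opp eqf_sqr.
  move=> z /=; apply/negP => /andP[/eqP-> /eqP y_opp].
  by case/negP: y_neq0; apply/eqP; lra.
have -> : count_mem (- y) s = count_mem y s.
  rewrite (seq.permP opp_s (pred1 y)) count_map; apply: eq_count => z /=.
  by rewrite eqr_oppLR.
by rewrite addnn odd_double.
Qed.

(** As in [sorted_nonpos_pairing], the index 0 is on its own for [n] odd. *)
Lemma ler_sum_pairs (R : numDomainType) (n : nat) (f g : nat -> R) :
  (odd n -> f 0%N <= g 0%N) ->
  (forall p, odd p = odd n -> (p.+1 < n)%N -> f p + f p.+1 <= g p + g p.+1) ->
  \sum_(p < n) f p <= \sum_(p < n) g p.
Proof.
have [k] := ubnP n; elim: k n => // k IHk [|[|n]] lt_nk fg0 fgS.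
- by rewrite !big_ord0.
- by rewrite !big_ord1 fg0.
rewrite !big_ord_recr /= -!addrA lerD ?fgS ?negbK //.
apply: IHk; first exact: ltnW.
  by move=> odd_n; rewrite fg0 //= negbK.
by move=> p odd_p lt_pn; rewrite fgS ?negbK //; lia.
by rewrite /= negbK.
Qed.

(** * Spectrum of a skew matrix and of its square *)

Lemma char_poly_conj_diag (F : fieldType) (n : nat) (P : 'M[F]_n)
  (d : 'rV[F]_n) :
  P \in unitmx ->
  char_poly (invmx P *m diag_mx d *m P) = \prod_(x <- codom (d 0)) ('X - x%:P).
Proof.
move=> P_unit; pose Q := map_mx (@polyC F) P.
have Q_unit : Q \in unitmx by rewrite map_unitmx.
transitivity (char_poly (diag_mx d)).
  rewrite /char_poly /char_poly_mx !map_mxM /= map_invmx -/Q.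
  have {1}-> : 'X%:M = invmx Q *m 'X%:M *m Q :> 'M_n.
    by rewrite scalar_mxC -mulmxA mulVmx ?mulmx1.
  rewrite -mulmxBl -mulmxBr !det_mulmx mulrAC -det_mulmx mulVmx //.
  by rewrite det1 mul1r.
rewrite char_poly_trig ?diag_mx_is_trig // codomE big_map big_enum /=.
by apply: eq_bigr => i _; rewrite mxE eqxx mulr1n.
Qed.

(** [K] and [- K = K^T] have the same characteristic polynomial. *)
Lemma skew_spectrum_opp (F : fieldType) (n : nat) (K P : 'M[F]_n)
  (d : 'rV[F]_n) :
  P \in unitmx -> K^T = - K -> K = invmx P *m diag_mx d *m P ->
  perm_eq (codom (d 0)) (codom ((- d) 0)).
Proof.
move=> P_unit skewK defK; apply: prod_XsubC_eq.
rewrite -!(char_poly_conj_diag _ P_unit) raddfN mulmxN mulNmx -defK -skewK.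
by rewrite /char_poly -det_tr /char_poly_mx raddfB /= tr_scalar_mx map_trmx.
Qed.

Lemma skewherm_spectral (C : numClosedFieldType) (n : nat) (K : 'M[C]_n) :
  K ^t* = - K ->
  exists (P : 'M[C]_n) (d : 'rV[C]_n),
    [/\ P \is unitarymx, K = P^t* *m diag_mx d *m P & map_mx Num.conj d = - d].
Proof.
move=> skewK; have : K \is normalmx.
  by apply/normalmxP; rewrite skewK mulmxN mulNmx.
move=> /orthomx_spectralP; set P := spectralmx K; set d := spectral_diag K.
have P_unitary : P \is unitarymx := spectral_unitarymx K.
rewrite invmx_unitary // => defK; exists P, d; split=> //.
have {skewK} : P^t* *m diag_mx (map_mx Num.conj d) *m P = P^t* *m diag_mx (- d)
  *m P.
  rewrite [diag_mx (- d)]raddfN mulmxN mulNmx -defK -skewK [in RHS]defK.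
  by rewrite !trmx_mul !map_mxM trmxCK tr_diag_mx map_diag_mx mulmxA.
have PPt : P *m P^t* = 1%:M by apply/unitarymxP.
move/(congr1 (fun X => P *m X *m P^t*)).
rewrite !mulmxA PPt !mul1mx -!mulmxA PPt !mulmx1 => /matrixP eq_d.
by apply/rowP => j; have := eq_d j j; rewrite !mxE eqxx !mulr1n.
Qed.

(** The complex eigenvalues of [K] are the ['i * r 0 j]; the weights
    [w i j = |P j i|^2] come from a unitary diagonalisation [P] and are real
    even though [P] is not, so nothing complex is left in the statement. *)
Lemma skew_square_spectral (R : rcfType) (n : nat) (K : 'M[R]_n) :
  K^T = - K ->
  exists (w : 'M[R]_n) (r : 'rV[R]_n),
    [/\ [/\ forall i j, 0 <= w i j, forall i, \sum_j w i j = 1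
          & forall j, \sum_i w i j = 1],
        perm_eq (codom (r 0)) (codom ((- r) 0)),
        forall i, (K *m K) i i = \sum_j w i j * - r 0 j ^+ 2
      & \tr (K *m K *m (K *m K)) = \sum_j (- r 0 j ^+ 2) ^+ 2].
Proof.
move=> skewK; pose f : {rmorphism R -> R[i]} := real_complex R;
  pose Kc := map_mx f K.
have f_inj : injective f := @complexI R.
have conjf x : (f x)^* = f x by exact: conjc_real.
have skewKc : Kc ^T = - Kc by rewrite map_trmx skewK raddfN.
have [|P [d [P_unitary defK conj_d]]] := @skewherm_spectral R[i] n Kc.
  by rewrite skewKc; apply/matrixP => i j; rewrite !mxE rmorphN /= conjf.
pose r : 'rV[R]_n := map_mx (@complex.Im R) d.
have def_d j : d 0 j = 'i * f (r 0 j).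
  have := congr1 (fun v : 'rV_n => complex.Re (v 0 j)) conj_d; rewrite !mxE.
  case: (d 0 j) => a b /= a_eq; have {a_eq}-> : a = 0 by lra.
  apply/eqP; rewrite -complexiE eq_complex /=; apply/andP; split; apply/eqP;
    ring.
have d2 j : d 0 j ^+ 2 = f (- r 0 j ^+ 2).
  by rewrite def_d exprMn sqrCi mulN1r rmorphN rmorphXn.
have PPt : P *m P^t* = 1%:M by apply/unitarymxP.
have PtP : P^t* *m P = 1%:M by apply/mulmx1C.
pose w : 'M[R]_n := \matrix_(i, j)
  (complex.Re (P j i) ^+ 2 + complex.Im (P j i) ^+ 2).
have wE i j : f (w i j) = (P j i)^* * P j i.
  by rewrite mxE mulrC -sqr_normc -add_Re2_Im2.
have K2 : Kc *m Kc = P^t* *m diag_mx (\row_j f (- r 0 j ^+ 2)) *m P.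
  rewrite {1}defK {1}defK !mulmxA -[_ *m P *m _]mulmxA PPt mulmx1.
  rewrite -[_ *m diag_mx d *m diag_mx d]mulmxA mulmx_diag;
    congr (_ *m diag_mx _ *m _).
  apply/rowP => j; rewrite [LHS]mxE [RHS]mxE.
  by rewrite -d2 expr2.
exists w, r; split.
- split=> [i j|i|j]; first by rewrite mxE addr_ge0 ?sqr_ge0.
  + apply: f_inj; rewrite rmorph_sum rmorph1.
    have /matrixP/(_ i i) := PtP; rewrite !mxE eqxx mulr1n => <-.
    by apply: eq_bigr => j _; rewrite wE !mxE.
  + apply: f_inj; rewrite rmorph_sum rmorph1.
    have /matrixP/(_ j j) := PPt; rewrite !mxE eqxx mulr1n => <-.
    by apply: eq_bigr => i _; rewrite wE !mxE mulrC.
- have := @skew_spectrum_opp _ n Kc P d (unitarymx_unit P_unitary) skewKc.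
  rewrite invmx_unitary // => /(_ defK)/(perm_map (@complex.Im R)).
  have map_Im (v : 'rV[R[i]]_n) :
      map (@complex.Im R) (codom (v 0)) = codom (map_mx (@complex.Im R) v 0).
    by rewrite !codomE -map_comp; apply: eq_map => j; rewrite /= mxE.
  rewrite !map_Im; suff -> : map_mx (@complex.Im R) (- d) = - r by [].
  by apply/rowP => j; rewrite !mxE; case: (d 0 j).
- move=> i; apply: f_inj.
  have -> : f ((K *m K) i i) = (Kc *m Kc) i i by rewrite -map_mxM [RHS]mxE.
  rewrite K2 rmorph_sum mul_mx_diag mxE; apply: eq_bigr => j _.
  by rewrite rmorphM wE !mxE /= mulrAC.
- apply: f_inj; rewrite [RHS]rmorph_sum.
  have -> : f (\tr (K *m K *m (K *m K))) = \tr (Kc *m Kc *m (Kc *m Kc)).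
    by rewrite -!map_mxM -trace_map_mx.
  rewrite K2 !mulmxA -[_ *m P *m _]mulmxA PPt mulmx1 -!mulmxA mxtrace_mulC.
  rewrite -!mulmxA PPt mulmx1 mulmx_diag mxtrace_diag.
  by apply: eq_bigr => j _; rewrite !mxE rmorphXn expr2.
Qed.

(** Sorting the eigenvalues of [K *m K] decreasingly, which permutes the
    columns of the doubly stochastic weights, gives the lower bound on the
    objective in which eigenvalues are matched with [a] in order. *)
Lemma skew_square_lower_bound (R : rcfType) (n : nat) (K : 'M[R]_n)
    (a : nat -> R) :
  K^T = - K -> (forall i j, (i <= j < n)%N -> a j <= a i) ->
  exists m : nat -> R,
    [/\ forall p, m p <= 0, odd n -> m 0%N = 0,
        forall p, odd p = odd n -> (p.+1 < n)%N -> m p = m p.+1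
      & \sum_(p < n) (m p ^+ 2 - 2 * a p * m p) <=
        \tr (K *m K *m (K *m K)) - 2 * \sum_(p < n) a p * (K *m K) p p].
Proof.
move=> skewK a_noninc.
have [w [r [[w_ge0 rows cols] opp_r diagK trK]]] := skew_square_spectral skewK.
pose t := [tuple - r 0 j ^+ 2 | j < n]; pose s := sort >=%R t.
have size_s : size s = n by rewrite size_sort size_tuple.
have /tuple_permP[p def_s] : perm_eq s t by rewrite perm_sort.
have s_nth (j : 'I_n) : s`_j = - r 0 (p j) ^+ 2.
  by rewrite def_s -tnth_nth !tnth_mktuple.
have s_sorted : sorted >=%R s by apply: sort_sorted => x y; apply: le_total.
have s_le0 : all (<= 0) s.
  rewrite all_sort; apply/allP => _ /mapP[j _ ->].
  by rewrite /= oppr_le0 sqr_ge0.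
have [|s0 s_pairs] := sorted_nonpos_pairing s_sorted s_le0.
  move=> x x_neq0; rewrite (seq.permP (permEl (perm_sort _ _))).
  have -> : t = [seq - y ^+ 2 | y <- codom (r 0)] :> seq R.
    by rewrite codomE -map_comp.
  apply: count_opp_sqr_even x_neq0.
  suff -> : [seq - y | y <- codom (r 0)] = codom ((- r) 0) by [].
  by rewrite !codomE -map_comp; apply: eq_map => j; rewrite /= mxE.
exists (fun j => s`_j); split.
- move=> j; have [lt_js|/(nth_default 0) -> //] := ltnP j (size s).
  by apply: (allP s_le0); rewrite mem_nth.
- by rewrite -size_s.
- by rewrite -{1 2}size_s.
have -> : \tr (K *m K *m (K *m K)) = \sum_(j < n) s`_j ^+ 2.
  rewrite trK (reindex_inj (@perm_inj _ p)) /=.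
  by apply: eq_bigr => j _; rewrite s_nth.
rewrite sumrB lerD2l lerN2.
under [leRHS]eq_bigr do rewrite -mulrA.
rewrite -mulr_sumr ler_pM2l ?ltr0n //.
have -> : \sum_(i < n) a i * (K *m K) i i =
    \sum_(i < n) a i * (\sum_(j < n) (\matrix_(i, j) w i (p j)) i j * s`_j).
  apply: eq_bigr => i _; rewrite diagK (reindex_inj (@perm_inj _ p)) /=.
  by congr (_ * _); apply: eq_bigr => j _; rewrite mxE s_nth.
apply: doubly_stochastic_rearrangement => //.
- by move=> i j; rewrite mxE.
- move=> i; rewrite -(rows i) [RHS](reindex_inj (@perm_inj _ p)) /=.
  by apply: eq_bigr => j _; rewrite mxE.
- by move=> j; rewrite -(cols (p j)); apply: eq_bigr => i _; rewrite mxE.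
- move=> i j /andP[le_ij lt_jn].
  by apply: (sorted_leq_nth ge_trans ge_refl) => //;
    rewrite inE size_s ?(leq_ltn_trans le_ij).
Qed.

(** * Reduction of the Frobenius distance *)

Lemma skewmxP (R : fieldType) (n : nat) (K : 'M[R]_n) :
  reflect (K^T = - K) (K \is skewmx).
Proof.
rewrite is_hermitianmxE expr1 scaleN1r map_mx_id //.
by apply: (iffP eqP) => [{2}->|->]; rewrite opprK.
Qed.

Lemma frob_innerE (R : realType) (n : nat) (X Y : 'M[R]_n) :
  frob_inner X Y = \tr (X *m Y^T).
Proof.
by apply: eq_bigr => i _; rewrite mxE; apply: eq_bigr => j _; rewrite mxE.
Qed.

(** [U] being symmetric, [tr (U A) = tr (U A^T)] is the trace of [U] times the
    symmetric part of [A], which [N] diagonalises. *)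
Lemma frob_dist_conj (R : realType) (n : nat) (A N V : 'M[R]_n)
  (lambda : nat -> R) :
  V^T = V -> N^T *m N = 1%:M -> sym_part A = N *m diagn n lambda *m N^T ->
  let U := N *m V *m N^T in
  frob_inner (U - A) (U - A) =
  \tr (V *m V) - 2 * \sum_(i < n) lambda i.+1 * V i i + frob_inner A A.
Proof.
move=> symV orthN defB U.
have symU : U^T = U by rewrite !trmx_mul trmxK symV mulmxA.
have trUU : \tr (U *m U) = \tr (V *m V).
  rewrite /U !mulmxA -[_ *m N^T *m N]mulmxA orthN mulmx1 mxtrace_mulC.
  by rewrite !mulmxA orthN mul1mx.
have trUA : \tr (U *m A) = \sum_(i < n) lambda i.+1 * V i i.
  have -> : \tr (U *m A) = \tr (U *m sym_part A).
    have trUAt : \tr (U *m A^T) = \tr (U *m A).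
      by rewrite -mxtrace_tr trmx_mul trmxK symU mxtrace_mulC.
    rewrite /sym_part -scalemxAr mxtraceZ mulmxDr mxtraceD trUAt; lra.
  rewrite defB /U !mulmxA -[_ *m N^T *m N]mulmxA orthN mulmx1 mxtrace_mulC.
  rewrite !mulmxA orthN mul1mx mul_mx_diag; apply: eq_bigr => i _.
  by rewrite !mxE mulrC.
rewrite !frob_innerE linearB /= symU mulmxBl !mulmxBr !linearB /= trUU.
have -> : \tr (U *m A^T) = \tr (U *m A).
  by rewrite -mxtrace_tr trmx_mul trmxK symU mxtrace_mulC.
by rewrite [\tr (A *m U)]mxtrace_mulC trUA; lra.
Qed.

(** * The pairs of the approximant *)

(** Positions are counted from 0, whereas [lambda] and [d_star]
    are indexed from 1.  A position [p] with the parity of [n] starts a pair,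
    whose number is [p.+2 %/ 2] for both parities of [n]. *)
Lemma pair_sumE (R : realType) (n p : nat) (lambda : nat -> R) :
  odd p = odd n -> pair_sum n lambda (p.+2 %/ 2) = lambda p.+1 + lambda p.+2.
Proof.
rewrite /pair_sum => odd_p.
by case: ifP => odd_n; congr (lambda _ + lambda _); lia.
Qed.

Lemma d_star_pair (R : realType) (n p : nat) (lambda : nat -> R) :
  odd p = odd n ->
  d_star n lambda p.+1 = mu_star n lambda (p.+2 %/ 2) /\
  d_star n lambda p.+2 = mu_star n lambda (p.+2 %/ 2).
Proof.
rewrite /d_star => odd_p; case: ifP => odd_n; last first.
  by split; congr (mu_star _ _ _); lia.
have p_gt0 : (0 < p)%N by lia.
rewrite !eqSS (gtn_eqF p_gt0) /=.
by split=> //; congr (mu_star _ _ _); lia.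
Qed.

Lemma mu_star_le0 (R : realType) (n i : nat) (lambda : nat -> R) :
  mu_star n lambda i <= 0.
Proof. by rewrite /mu_star; case: ifP => // ?; lra. Qed.

Lemma d_star_le0 (R : realType) (n i : nat) (lambda : nat -> R) :
  d_star n lambda i <= 0.
Proof. by rewrite /d_star; do 2?case: ifP => _ //; apply: mu_star_le0. Qed.

(** [mu_star] is the projection on the nonpositive half-line of the vertex
    [pair_sum / 2] of the parabola. *)
Lemma mu_star_min (R : realType) (n i : nat) (lambda : nat -> R) (m : R) :
  m <= 0 ->
  mu_star n lambda i ^+ 2 - pair_sum n lambda i * mu_star n lambda i <=
  m ^+ 2 - pair_sum n lambda i * m.
Proof.
rewrite /mu_star; set s := pair_sum _ _ _ => m_le0.
case: (leP s 0) => [_|s_gt0]; rewrite -subr_ge0.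
  suff -> : m ^+ 2 - s * m - ((s / 2) ^+ 2 - s * (s / 2)) = (m - s / 2) ^+ 2.
    exact: sqr_ge0.
  by field.
by rewrite mulr0 expr0n !subr0 subr_ge0 (le_trans _ (sqr_ge0 m))
  // mulr_ge0_le0 // ltW.
Qed.

(** * The approximant is the square of a skew matrix *)

(** The involution that exchanges the two positions of a pair; for [n] odd,
    the truncated predecessor makes it fix the unpaired position 0. *)
Definition partner (n p : nat) : nat := if odd p == odd n then p.+1 else p.-1.

Lemma partner_lt (n : nat) (p : 'I_n) : (partner n p < n)%N.
Proof. by rewrite /partner; have := ltn_ord p; case: ifP; lia. Qed.

(** On the pair with value [mu <= 0] the square root is the block
    [0, s; - s, 0] with [s := Num.sqrt (- mu)], whose square is [mu] times the
    identity.  All blocks are written at once as [e p] at the positions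
    [(p, pi p)], where [pi] is the partner and [e] is odd under it. *)
Lemma approximant_skew_sq (R : realType) (n : nat) (N : 'M[R]_n)
  (lambda : nat -> R) :
  N^T *m N = 1%:M -> skew_sq_mx R n (skew_square_approximant N lambda).
Proof.
move=> orthN; pose d p := d_star n lambda p.+1.
pose pi (p : 'I_n) : 'I_n := Ordinal (partner_lt p).
pose e (p : 'I_n) : R := (if odd p == odd n then 1 else - 1) * Num.sqrt (- d p).
have pi_fix (p : 'I_n) : odd p != odd n -> val p = 0%N -> pi p = p /\ e p = 0.
  move=> odd_p p0; split; first by apply: val_inj;
    rewrite /= /partner (negPf odd_p) p0.
  rewrite /e /d p0; move: odd_p; rewrite p0 /d_star /=; case: (odd n) => //= _.
  by rewrite oppr0 sqrtr0 mulr0.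
have piK : involutive pi.
  move=> p; apply: val_inj; rewrite /= /partner.
  by do 2 (case: ifP => /=); lia.
have e_pi p : e (pi p) = - e p.
  have [odd_p|odd_p] := eqVneq (odd p) (odd n).
    have [d1 d2] := @d_star_pair R n p lambda odd_p.
    rewrite /e /d /= /partner odd_p eqxx /= d1 d2 odd_p.
    by case: (odd n); rewrite /= mul1r mulN1r.
  (* [p] ends a pair, unless it is the unpaired position 0. *)
  case: (posnP p) => [p0|p_gt0].
    by have [-> ->] := pi_fix p odd_p p0; rewrite oppr0.
  have odd_q : odd p.-1 = odd n by lia.
  have [d1 d2] := @d_star_pair R n p.-1 lambda odd_q.
  rewrite prednK // in d1 d2.
  rewrite /e /d /= /partner (negPf odd_p) odd_q eqxx prednK // d1 d2.
  by rewrite mulN1r opprK mul1r.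
pose K0 : 'M[R]_n := \matrix_(p, q) (e p *+ (q == pi p)).
have skewK0 : K0^T = - K0.
  apply/matrixP => p q; rewrite !mxE.
  have [->|neq_p] := eqVneq p (pi q); first by rewrite piK eqxx e_pi opprK.
  case: eqVneq => [def_q|_]; last by rewrite oppr0.
  by rewrite def_q piK eqxx in neq_p.
have K02 : K0 *m K0 = diagn n (d_star n lambda).
  apply/matrixP => p q;
    rewrite !mxE (bigD1 (pi p)) //= big1 ?addr0 => [|k neq_k].
    rewrite !mxE eqxx piK e_pi mulr1n eq_sym -[X in X * _]mulr1n.
    case: eqVneq => _; rewrite ?mulr0 //= !mulr1n mulrN -expr2.
    rewrite /e exprMn sqr_sqrtr ?oppr_ge0 ?d_star_le0 //.
    by case: ifP; rewrite ?sqrrN expr1n mul1r opprK.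
  by rewrite !mxE (negPf neq_k) mul0r.
exists (N *m K0 *m N^T).
  by apply/skewmxP; rewrite !trmx_mul trmxK skewK0 mulNmx mulmxN mulmxA.
by rewrite /skew_square_approximant -K02 !mulmxA -[_ *m N^T *m N]mulmxA orthN
  mulmx1.
Qed.

(** * Optimality *)

Theorem theorem3 (R : realType) (n : nat) (hn : (1 <= n)%N)
    (A N : 'M[R]_n) (lambda : nat -> R)
    (hA : spectral_decomposition A N lambda) :
  skew_sq_mx R n (skew_square_approximant N lambda) /\
  (forall U : 'M[R]_n, skew_sq_mx R n U ->
     frob_norm (skew_square_approximant N lambda - A) <= frob_norm (U - A)).
Proof.
have [orthN lambda_noninc defB] := hA.
split; first exact: approximant_skew_sq.
move=> _ [K /skewmxP skewK <-].
have NNt : N *m N^T = 1%:M by apply: mulmx1C.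
pose K' := N^T *m K *m N.
have skewK' : K'^T = - K' by rewrite !trmx_mul trmxK skewK mulNmx mulmxN mulmxA.
have -> : K *m K = N *m (K' *m K') *m N^T.
  rewrite /K' !mulmxA NNt mul1mx -!mulmxA NNt mulmx1.
  by rewrite [N *m (N^T *m _)]mulmxA NNt mul1mx.
have symK2 : (K' *m K')^T = K' *m K' by rewrite trmx_mul skewK' mulNmx mulmxN
  opprK.
rewrite ler_sqrt; last by apply: sumr_ge0 => i _; apply: sumr_ge0 => j _;
  rewrite -expr2 sqr_ge0.
rewrite /skew_square_approximant !(frob_dist_conj _ orthN defB) ?tr_diag_mx //.
rewrite lerD2r.
have [|m [m_le0 m0 m_pair m_opt]] :=
  skew_square_lower_bound skewK' (a := fun i => lambda i.+1).
  by move=> i j /andP[le_ij lt_jn]; apply: lambda_noninc.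
apply: le_trans m_opt.
pose d p := d_star n lambda p.+1.
have -> : \tr (diagn n (d_star n lambda) *m diagn n (d_star n lambda)) -
    2 * \sum_(i < n) lambda i.+1 * diagn n (d_star n lambda) i i =
    \sum_(p < n) (d p ^+ 2 - 2 * lambda p.+1 * d p).
  rewrite mulmx_diag mxtrace_diag mulr_sumr -sumrB; apply: eq_bigr => p _.
  by rewrite !mxE eqxx mulr1n mulrA expr2.
apply: (@ler_sum_pairs _ _ (fun p => d p ^+ 2 - 2 * lambda p.+1 * d p)
                           (fun p => m p ^+ 2 - 2 * lambda p.+1 * m p)).
  by move=> odd_n; rewrite m0 // /d /d_star odd_n.
move=> p odd_p lt_pn; rewrite -m_pair // /d.
have [-> ->] := @d_star_pair R n p lambda odd_p.
have := @mu_star_min R n (p.+2 %/ 2) lambda (m p) (m_le0 p).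
rewrite pair_sumE //; lra.
Qed.
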